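(* Let $m,n \geq 2$ be fixed integers. As $q \to \infty$ through prime powers, $\mathrm{gen}_{m,n}(q)$ is strictly bounded above by, and is asymptotically equivalent to, $$\left( q-1 \right) q^{(m-1)n^2} \prod_{k=1}^{n} \left( 1 - q^{-k} \right)^{-1}.$$ In particular, $\mathrm{gen}_{m,n}(q)$ is asymptotically equivalent to $q^{(m-1)n^2 +1}$ as $m,n\geq 2$ are fixed and $q \to \infty$.
   Context: For a commutative ring $R$ with $1$, $M_n(R)$ is the $R$-algebra of $n\times n$ matrices over $R$, and $M_n(R)^k$ is the direct sum of $k$ copies of it with componentwise operations. A set $S$ generates an $R$-algebra $A$ if every element of $A$ is an $R$-linear combination of nonempty products of elements of $S$ (the identity element is not automatically included). An algebra ''has (admits) $m$ generators'' if it can be generated by $m$ elements. $\mathrm{gen}_{m,n}(R)$ is the integer such that the $R$-algebra $M_n(R)^{\mathrm{gen}_{m,n}(R)}$ admits $m$ generators, while $M_n(R)^{1+\mathrm{gen}_{m,n}(R)}$ needs at least $m+1$ generators; if every $R$-algebra $M_n(R)^k$ admits at most $m$ generators, then $\mathrm{gen}_{m,n}(R)=\infty$. For a prime power $q$, $\mathbb{F}_q$ is the field with $q$ elements and $\mathrm{gen}_{m,n}(q) = \mathrm{gen}_{m,n}(\mathbb{F}_q)$. Two functions $f(q),g(q)$ are asymptotically equivalent if $f(q)/g(q)\to 1$. *)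

(* Defs.v *)
From HB Require Import structures.
From mathcomp Require Import all_boot all_order all_algebra all_field.
From mathcomp Require Import all_classical all_reals all_analysis.

Set Implicit Arguments.
Unset Strict Implicit.
Unset Printing Implicit Defensive.

Import Order.TTheory GRing.Theory Num.Theory.
Import numFieldNormedType.Exports.

Local Open Scope classical_set_scope.
Local Open Scope ring_scope.

(* M_n(A)^k; finite functions carry pointwise operations.  The ring A may be
   zero, and n or k may be 0, so this is only a pzRingType and an lmodType A. *)
Definition mxpow (A : comPzRingType) (n k : nat) := {ffun 'I_k -> 'M[A]_n}.

(* Generation without identity: every element is a finite linear combination
   of products of nonempty words in S (pairs of a coefficient and a word). *)
Definition generates (A : comPzRingType) (n k : nat) (S : set (mxpow A n k)) :
    Prop :=
  forall x : {ffun 'I_k -> 'M[A]_n},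
  exists2 s : seq (A * seq {ffun 'I_k -> 'M[A]_n}),
    (forall t, t \in s -> t.2 != [::] /\ (forall y, y \in t.2 -> S y)) &
    x = \sum_(t <- s) t.1 *: \prod_(y <- t.2) y.

(* The m generators need not be distinct, so having m generators means being
   generated by a set of at most m elements. *)
Definition has_generators (A : comPzRingType) (n k m : nat) : Prop :=
  exists S : 'I_m -> mxpow A n k, generates (range S).

Definition is_gen (m n : nat) (A : comPzRingType) (g : nat) : Prop :=
  has_generators A n g m /\ ~ has_generators A n g.+1 m.

(* Since M_n(A)^0 = 0 has m generators for all m, no integer satisfies is_gen
   exactly when every M_n(A)^k has m generators.  The integer is otherwise
   unique, M_n(A)^k being a quotient of M_n(A)^k.+1. *)
Definition gen (m n : nat) (A : comPzRingType) : \bar nat :=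
  if pselect (exists g, is_gen m n A g) is left h then (projT1 (cid h))%:E
  else +oo%E.

Definition prime_power (q : nat) : Prop :=
  exists p e : nat, [/\ prime p, (0 < e)%N & q = (p ^ e)%N].

Lemma logn_pdiv_gt0 (q : nat) : (1 < q)%N -> (0 < logn (pdiv q) q)%N.
Proof.
move=> q1; rewrite logn_gt0 mem_primes pdiv_prime // pdiv_dvd andbT.
exact: ltnW.
Qed.

(* The field with q elements; a junk value when q is not a prime power. *)
Definition GF (q : nat) : finFieldType :=
  match @idP (1 < q)%N with
  | ReflectT q1 => s2val (pPrimePowerField (pdiv_prime q1) (logn_pdiv_gt0 q1))
  | ReflectF _ => 'F_2
  end.

Lemma card_GF (q : nat) : prime_power q -> #|GF q| = q.
Proof.
case=> p [[|e] [pp // _ ->]]; rewrite /GF; case: {-}_ / idP => [q1|].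
  by rewrite (s2valP' (pPrimePowerField _ _)) pdiv_pfactor // pfactorK.
by rewrite -(expn0 p) ltn_exp2l // prime_gt1.
Qed.

Definition genq (R : realType) (m n q : nat) : \bar R :=
  er_map (fun k : nat => k%:R) (gen m n (GF q)).

Definition prime_powers_infty : set_system nat :=
  within [set q | prime_power q] \oo.

Definition asymp_equiv (R : realType) (f : nat -> \bar R) (g : nat -> R) :
    Prop :=
  (f q * ((g q)^-1)%:E)%E @[q --> prime_powers_infty] --> 1%:E.

Definition gen_bound (R : realType) (m n q : nat) : R :=
  (q%:R - 1) * q%:R ^+ ((m - 1) * n ^ 2) *
  \prod_(1 <= k < n.+1) (1 - q%:R ^- k)^-1.

(* Main.v *)
Require Import Defs.
From mathcomp Require Import all_boot all_order all_fingroup all_algebra.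
From mathcomp Require Import all_classical all_reals all_analysis.
From mathcomp Require Import ring zify.
Import Order.TTheory GRing.Theory Num.Theory.
Import numFieldNormedType.Exports.
Local Open Scope ring_scope.

(** Let F be the field with q elements.  An m-tuple of elements of M_n(F)^k is
    a k-tuple of m-tuples in M_n(F), one for each factor.  It generates the
    product exactly when each of these m-tuples generates M_n(F) and no two of
    them are conjugate under GL_n(F): [generating_component] and
    [generating_nonconj] in one direction, [generating_ffun] in the other.
    Sufficiency rests on the simplicity of M_n(F) and on the Skolem-Noether
    theorem: if no element of the generated subalgebra is 1 in factor i and 0
    in factor j, then factor j determines factor i, and this correspondence is
    an inner automorphism that carries one m-tuple to the other.

    Consequently gen_{m,n}(q) is the number of GL_n(F)-orbits on the set G of
    generating m-tuples.  The stabilizer of a generating tuple consists of the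
    q - 1 scalars, so gen_{m,n}(q) = |G| (q - 1) / |GL_n(F)|.  By the formula
    for |GL_n(F)|, this is the bound of the theorem multiplied by the
    proportion |G| / q^(m n^2) of generating tuples ([num_orbits_ratio]).  The
    proportion is less than 1, because the zero tuple does not generate, and it
    remains to prove that it tends to 1.

    For this, let D(A, B) be the determinant whose n^2 rows are the matrices
    A^i B A^j with 0 <= i, j < n, written as vectors.  If D(A, B) is nonzero
    then A and B generate M_n(F).  D is a polynomial in the entries of A and B
    of degree bounded in terms of n, and it does not vanish when A is diagonal
    with distinct eigenvalues, which exists as soon as q >= n, and all the
    entries of B are 1.  Restricting D to the lines through this point and
    averaging over their directions ([card_nongenerating]) shows that D
    vanishes on a proportion O(1/q) of the pairs. *)

Set Implicit Arguments.
Unset Strict Implicit.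
Unset Printing Implicit Defensive.

(** * Generated subalgebras without identity *)

(** The scalar action is a parameter, so that one notion covers both M_n(F)
    and its powers. *)
Record subalgebra (F : Type) (V : pzSemiRingType) (sc : F -> V -> V)
    (P : V -> Prop) : Prop := Subalgebra {
  subalg0 : P 0;
  subalgD : forall x y, P x -> P y -> P (x + y);
  subalgZ : forall c x, P x -> P (sc c x);
  subalgM : forall x y, P x -> P y -> P (x * y)
}.

(** Generation stated by minimality: quantifying over all subalgebras turns
    every claim about a generated algebra into a check of closure properties. *)
Definition generating (F : Type) (V : pzSemiRingType) (sc : F -> V -> V)
    (J : Type) (a : J -> V) : Prop :=
  forall P, subalgebra sc P -> (forall y, P (a y)) -> forall x, P x.

Section Span.
Variables (F : comPzRingType) (n k : nat).
Local Notation scale := (fun c (x : {ffun 'I_k -> 'M[F]_n}) => c *: x).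
Implicit Types S : set (mxpow F n k).

Definition alg_span S (x : {ffun 'I_k -> 'M[F]_n}) : Prop :=
  exists2 s : seq (F * seq {ffun 'I_k -> 'M[F]_n}),
    (forall t, t \in s -> t.2 != [::] /\ (forall y, y \in t.2 -> S y)) &
    x = \sum_(t <- s) t.1 *: \prod_(y <- t.2) y.

(** The product of two combinations of nonempty words expands into a
    combination of concatenated words, which are again nonempty. *)
Lemma alg_span_subalgebra S : subalgebra scale (alg_span S).
Proof.
split=> [|_ _ [s sS ->] [t tS ->]|c _ [s sS ->]|_ _ [s sS ->] [t tS ->]].
- by exists [::]; rewrite ?big_nil.
- exists (s ++ t); last by rewrite big_cat.
  by move=> u; rewrite mem_cat => /orP[/sS|/tS].
- exists [seq (c * u.1, u.2) | u <- s].
    by move=> _ /mapP[u /sS[? ?] ->].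
  by rewrite big_map scaler_sumr; apply: eq_bigr => u _; rewrite scalerA.
exists [seq (u.1 * v.1, u.2 ++ v.2) | u <- s, v <- t].
  move=> _ /allpairsP[[u v] /= [/sS[u0 uS] /tS[v0 vS] ->]] /=; split.
    by case: (u.2) u0.
  by move=> y; rewrite mem_cat => /orP[/uS|/vS].
rewrite big_allpairs_dep mulr_suml; apply: eq_bigr => u _.
rewrite mulr_sumr; apply: eq_bigr => v _ /=.
rewrite big_cat /=; apply/ffunP=> i; rewrite !ffunE.
by rewrite -!mulmxE -scalemxAl -scalemxAr scalerA.
Qed.

Lemma alg_span_gen S x : S x -> alg_span S x.
Proof.
move=> Sx; exists [:: (1, [:: x])]; last by rewrite !big_seq1 scale1r.
by move=> t; rewrite inE => /eqP-> /=; split=> // y; rewrite inE => /eqP->.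
Qed.

Lemma alg_span_min S (P : {ffun 'I_k -> 'M[F]_n} -> Prop) :
  subalgebra scale P -> (forall y, S y -> P y) ->
  forall x, alg_span S x -> P x.
Proof.
case=> P0 PD PZ PM SP x [s sS ->].
rewrite big_seq; elim/big_ind: _ => // -[c w] /sS[/= w0 wS]; apply: PZ.
elim: w w0 wS => // y [|z w] IH _ wS.
  by rewrite big_seq1; apply/SP/wS/mem_head.
rewrite big_cons; apply: PM; first by apply/SP/wS/mem_head.
by apply: IH => // v vw; apply: wS; rewrite inE vw orbT.
Qed.

Lemma has_generatorsP m :
  has_generators F n k m <->
  exists S : 'I_m -> {ffun 'I_k -> 'M[F]_n}, generating scale S.
Proof.
split=> -[S gS]; exists S.
  move=> P Pcl PS x; apply: (alg_span_min Pcl) (gS x) => _ [y _ <-].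
  exact: PS.
move=> x; apply: gS (alg_span_subalgebra _) _ x => y.
by apply: alg_span_gen; exists y.
Qed.
End Span.

(** * The Skolem-Noether theorem for matrix algebras *)

(** For a suitable j and a column v of phi(E_jj), the matrix g whose i-th
    column is phi(E_ij) v satisfies phi(x) g = g x by construction.  It is
    nonzero, and its kernel is stable under all matrices, so it is
    invertible. *)
Lemma skolem_noether (F : fieldType) n (phi : 'M[F]_n -> 'M[F]_n) :
  {morph phi : x y / x + y} -> (forall c, {morph phi : x / c *: x}) ->
  {morph phi : x y / x *m y} -> (exists x, phi x != 0) ->
  exists2 g : 'M[F]_n, g \in unitmx & forall x, phi x *m g = g *m x.
Proof.
move=> phiD phiZ phiM [x0 phix0].
have phi0 : phi 0 = 0 by have := phiZ 0 0; rewrite !scale0r.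
have phi_sum (I : finType) (f : I -> 'M[F]_n) :
    phi (\sum_i f i) = \sum_i phi (f i).
  by apply: (big_morph _ phiD phi0).
have [j phij] : exists j, phi (delta_mx j j) != 0.
  apply/existsP; move: phix0; apply: contraNT.
  rewrite negb_exists => /forallP h.
  rewrite -[x0]mulmx1 phiM mx1_sum_delta phi_sum big1 ?mulmx0 // => i _.
  by apply/eqP; move: (h i); rewrite negbK.
have [l phijl] : exists l, col l (phi (delta_mx j j)) != 0.
  apply/existsP; apply: contraNT phij; rewrite negb_exists => /forallP h.
  apply/eqP/matrixP=> r l; move: (h l); rewrite negbK => /eqP/colP/(_ r).
  by rewrite !mxE.
pose v := col l (phi (delta_mx j j)).
pose g := \matrix_(r, i) (phi (delta_mx i j) *m v) r ord0.
have colg i : col i g = phi (delta_mx i j) *m v.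
  by apply/colP=> r; rewrite !mxE.
have phig x : phi x *m g = g *m x.
  apply/matrixP=> r i.
  have -> : (phi x *m g) r i = (phi x *m col i g) r 0.
    by rewrite !mxE; apply: eq_bigr => s _; rewrite !mxE.
  rewrite colg mulmxA -phiM.
  have -> : x *m delta_mx i j = \sum_s x s i *: delta_mx s j.
    apply/matrixP=> a b; rewrite summxE !mxE.
    rewrite (bigD1 i) //= big1 => [|s si]; last by rewrite mxE (negPf si) mulr0.
    rewrite (bigD1 a) //= big1 => [|s si].
      by rewrite !mxE !eqxx /= !addr0.
    by rewrite !mxE eq_sym (negPf si) mulr0.
  rewrite phi_sum mulmx_suml summxE !mxE; apply: eq_bigr => s _.
  by rewrite phiZ -scalemxAl -colg !mxE mulrC.
exists g => //.
(* column j of g is phi(E_jj) v = v, since v is a column of the idempotent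
   phi(E_jj) *)
have g0 : g != 0.
  apply: contraNneq phijl => g0; rewrite -/v.
  have := colg j; rewrite /v [col l _]colE.
  rewrite mulmxA -phiM mul_delta_mx -colE => <-.
  by rewrite g0; apply/eqP/colP=> r; rewrite !mxE.
(* if g u = 0 with u_i != 0, then g E_si u = 0, which is u_i times column s
   of g, so that g = 0 *)
rewrite -unitmx_tr -row_free_unit -kermx_eq0; apply: contraNT g0 => /rowV0Pn[w].
rewrite sub_kermx => /eqP wg w0.
have gw : g *m w^T = 0 by apply: trmx_inj; rewrite trmx_mul trmxK wg trmx0.
have [i wi] : exists i, w 0 i != 0.
  apply/existsP; apply: contraNT w0; rewrite negb_exists => /forallP h.
  by apply/eqP/rowP=> i; move: (h i); rewrite negbK mxE => /eqP.
apply/eqP/matrixP=> r s; rewrite [RHS]mxE.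
have dw : delta_mx s i *m w^T = w 0 i *: delta_mx s 0.
  apply/colP=> t; rewrite !mxE (bigD1 i) //= big1 => [|u ui].
    by rewrite !mxE !eqxx andbT addr0 mulrC.
  by rewrite mxE (negPf ui) andbF mul0r.
have : g *m (delta_mx s i *m w^T) = 0.
  by rewrite mulmxA -phig -mulmxA gw mulmx0.
rewrite dw -scalemxAr -colE => /colP/(_ r); rewrite !mxE => /eqP.
by rewrite mulf_eq0 (negPf wi) /= => /eqP.
Qed.

(** * Generating tuples of a power of a matrix algebra *)

Section Components.
Variables (F : fieldType) (n' : nat) (J : Type).
Local Notation n := n'.+1.
Local Notation M := 'M[F]_n.

Definition generates_mx (a : J -> M) := generating (fun c (x : M) => c *: x) a.

(** Written without inverses, so that it passes through sums and products as
    an intertwining relation. *)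
Definition conjugate_mx (a b : J -> M) :=
  exists2 g : M, g \in unitmx & forall y, a y *m g = g *m b y.

Variables (k : nat) (S : J -> {ffun 'I_k -> M}).
Local Notation scale := (fun c (x : {ffun 'I_k -> M}) => c *: x).

Lemma subalgebra_component P i : subalgebra scale P ->
  subalgebra (fun c (x : M) => c *: x) (fun x => exists2 z, P z & z i = x).
Proof.
case=> P0 PD PZ PM; split.
- by exists 0 => //; rewrite ffunE.
- by move=> _ _ [z Pz <-] [t Pt <-]; exists (z + t);
    rewrite ?ffunE; first exact: PD.
- by move=> c _ [z Pz <-]; exists (c *: z); rewrite ?ffunE //; apply: PZ.
- by move=> _ _ [z Pz <-] [t Pt <-]; exists (z * t);
    rewrite ?ffunE //; apply: PM.
Qed.

Lemma subalgebra_preim i (P : M -> Prop) :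
  subalgebra (fun c (x : M) => c *: x) P -> subalgebra scale (fun z => P (z i)).
Proof.
case=> P0 PD PZ PM; split; first by rewrite ffunE.
- by move=> x y Px Py; rewrite ffunE; apply: PD.
- by move=> c x Px; rewrite ffunE; apply: PZ.
- by move=> x y Px Py; rewrite ffunE; apply: PM.
Qed.

Lemma generating_component i :
  generating scale S -> generates_mx (fun y => S y i).
Proof.
move=> gS P Pcl PS x.
by have := gS _ (subalgebra_preim i Pcl) PS [ffun=> x]; rewrite ffunE.
Qed.

(** The elements whose factors i and j are intertwined by g form a subalgebra,
    and it does not contain the idempotent that is 1 in factor i and 0 in the
    other factors. *)
Lemma generating_nonconj i j : generating scale S -> i != j ->
  ~ conjugate_mx (fun y => S y i) (fun y => S y j).
Proof.
move=> gS ij [g gu Sg].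
suff: ([ffun l => if l == i then 1 else 0] i : M) *m g =
    g *m [ffun l => if l == i then 1 else 0] j.
  rewrite !ffunE eqxx eq_sym (negPf ij) mul1mx mulmx0 => g0.
  by move: gu; rewrite g0 unitmxE det0 unitr0.
apply: (gS (fun z => z i *m g = g *m z j)) => //; split.
- by rewrite !ffunE mul0mx mulmx0.
- by move=> x y ex ey; rewrite !ffunE mulmxDl ex ey mulmxDr.
- by move=> c x ex; rewrite !ffunE -scalemxAl ex scalemxAr.
- by move=> x y ex ey; rewrite !ffunE -!mulmxE -mulmxA ey !mulmxA ex.
Qed.

(** Simplicity of the matrix algebra: if x_pq is nonzero then E_rr is
    proportional to E_rp x E_qr, and 1 is the sum of the E_rr. *)
Lemma mx_ideal_full (P : M -> Prop) :
  subalgebra (fun c (x : M) => c *: x) P ->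
  (forall x y, P y -> P (x *m y)) -> (forall x y, P y -> P (y *m x)) ->
  forall x, P x -> x != 0 -> P 1.
Proof.
case=> P0 PD PZ _ PMl PMr x Px x0.
have [p [q xpq]] : exists p q, x p q != 0.
  suff /existsP[p /existsP[q xpq]] : [exists p, exists q, x p q != 0].
    by exists p, q.
  apply: contraNT x0; rewrite negb_exists => /forallP h.
  apply/eqP/matrixP=> p q; move: (h p); rewrite negb_exists => /forallP/(_ q).
  by rewrite negbK mxE => /eqP.
rewrite -[1]/(1%:M) mx1_sum_delta; elim/big_ind: _ => // r _.
have -> : delta_mx r r = (x p q)^-1 *: (delta_mx r p *m x *m delta_mx q r).
  suff -> : delta_mx r p *m x *m delta_mx q r = x p q *: delta_mx r r.
    by rewrite scalerA mulVf // scale1r.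
  apply/matrixP=> s t; rewrite !mxE (bigD1 q) //= big1 => [|u uq]; last first.
    by rewrite !mxE (negPf uq) mulr0.
  rewrite !mxE (bigD1 p) //= big1 => [|u up]; last first.
    by rewrite !mxE (negPf up) andbF mul0r.
  by rewrite !mxE !eqxx andbT !addr0 -mulnb natrM;
    case: eqP; case: eqP; rewrite ?mulr0 ?mul0r ?mulr1 ?mul1r.
by apply: PZ; apply: PMr; apply: PMl.
Qed.

(** The factors i of the elements of P that vanish in factor j form a
    two-sided ideal.  If it is nonzero it contains 1.  If it is zero, factor j
    of an element of P determines its factor i, and the resulting multiplicative
    map is inner, which makes the two tuples conjugate. *)
Lemma separating_element P i j : subalgebra scale P -> (forall y, P (S y)) ->
  generates_mx (fun y => S y i) -> generates_mx (fun y => S y j) ->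
  ~ conjugate_mx (fun y => S y i) (fun y => S y j) ->
  exists2 z, P z & z i = 1 /\ z j = 0.
Proof.
move=> Pcl PS gi gj nconj; have [P0 PD PZ PM] := Pcl.
have surj l : generates_mx (fun y => S y l) ->
    forall x, exists2 z, P z & z l = x.
  by move=> gl; apply: gl => [|y]; [exact: subalgebra_component | exists (S y)].
pose I x := exists2 z, P z & z i = x /\ z j = 0.
have Isub : subalgebra (fun c (x : M) => c *: x) I.
  split.
  - by exists 0; rewrite ?ffunE.
  - move=> _ _ [z Pz [<- zj]] [t Pt [<- tj]]; exists (z + t); first exact: PD.
    by rewrite !ffunE zj tj addr0.
  - move=> c _ [z Pz [<- zj]]; exists (c *: z); first exact: PZ.
    by rewrite !ffunE zj scaler0.
  - move=> _ _ [z Pz [<- zj]] [t Pt [<- tj]]; exists (z * t); first exact: PM.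
    by rewrite !ffunE zj tj mul0r.
case: (pselect (exists2 x, I x & x != 0)) => [[x Ix x0]|I0].
  apply: (mx_ideal_full Isub _ _ Ix x0).
    move=> u _ [z Pz [<- zj]]; have [t Pt tu] := surj i gi u.
    by exists (t * z); [exact: PM | rewrite !ffunE tu zj mulr0].
  move=> u _ [z Pz [<- zj]]; have [t Pt tu] := surj i gi u.
  by exists (z * t); [exact: PM | rewrite !ffunE tu zj mul0r].
case: nconj.
have PN z : P z -> P (- z) by move=> Pz; rewrite -scaleN1r; apply: PZ.
(* factor j determines factor i, the ideal being zero *)
have uniq_i z t : P z -> P t -> z j = t j -> z i = t i.
  move=> Pz Pt ztj; apply/eqP; rewrite -subr_eq0; apply/negPn/negP => zt0.
  case: I0; exists (z i - t i) => //; exists (z - t).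
    by apply: PD => //; apply: PN.
  by rewrite !ffunE ztj subrr.
have /choice[lift liftP] : forall x, exists z, P z /\ z j = x.
  by move=> x; have [z] := surj j gj x; exists z.
have liftE z : P z -> lift (z j) i = z i.
  by move=> Pz; have [Pl lj] := liftP (z j); apply: uniq_i.
have [||||g gu phig] := @skolem_noether F n (fun x => lift x i).
- move=> x y; have [[Px xj] [Py yj]] := (liftP x, liftP y).
  by have := liftE _ (PD _ _ Px Py); rewrite !ffunE xj yj.
- move=> c x; have [Px xj] := liftP x.
  by have := liftE _ (PZ c _ Px); rewrite !ffunE xj.
- move=> x y; have [[Px xj] [Py yj]] := (liftP x, liftP y).
  by have := liftE _ (PM _ _ Px Py); rewrite !ffunE xj yj.
- have [z Pz zi] := surj i gi 1.
  by exists (z j); rewrite liftE // zi oner_neq0.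
by exists g => // y; rewrite -phig liftE.
Qed.

(** The product over j != i of the elements that separate i from j is the
    idempotent of factor i, so the generated subalgebra contains each factor. *)
Lemma generating_ffun :
  (forall i, generates_mx (fun y => S y i)) ->
  (forall i j, i != j -> ~ conjugate_mx (fun y => S y i) (fun y => S y j)) ->
  generating scale S.
Proof.
move=> gS nconj P Pcl PS; have [P0 PD PZ PM] := Pcl.
have unit_at i : exists2 e, P e & e i = 1 /\ forall j, j != i -> e j = 0.
  suff [e Pe [ei eN]] : exists2 e, P e &
      e i = 1 /\ forall j, j \in rem i (enum 'I_k) -> e j = 0.
    exists e => //; split=> // j ji; apply: eN.
    by rewrite mem_rem_uniq ?enum_uniq // inE ji mem_enum.
  have : i \notin rem i (enum 'I_k) by rewrite mem_rem_uniqF ?enum_uniq.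
  elim: (rem i _) => [_|j s IH].
    have [e Pe ei] : exists2 e, P e & e i = 1.
      by apply: (gS i) (subalgebra_component i Pcl) _ 1 => y; exists (S y).
    by exists e.
  rewrite inE negb_or => /andP[ij /IH[e Pe [ei es]]].
  have [f Pf [fi fj]] := separating_element Pcl PS (gS i) (gS j) (nconj i j ij).
  exists (e * f); first exact: PM.
  rewrite !ffunE ei fi mulr1; split=> // l.
  rewrite inE ffunE => /orP[/eqP->|/es->].
    by rewrite fj mulr0.
  by rewrite mul0r.
move=> x; suff -> : x = \sum_i [ffun l => if l == i then x i else 0].
  elim/big_ind: _ => // i _; have [e Pe [ei eN]] := unit_at i.
  have [z Pz zi] : exists2 z, P z & z i = x i.
    by apply: (gS i) (subalgebra_component i Pcl) _ (x i) => y; exists (S y).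
  suff -> : [ffun l => if l == i then x i else 0] = e * z by apply: PM.
  apply/ffunP=> l; rewrite !ffunE; case: eqP => [->|/eqP li].
    by rewrite ei mul1r zi.
  by rewrite eN // mul0r.
apply/ffunP=> l; rewrite sum_ffunE (bigD1 l) //= big1 => [|i il].
  by rewrite ffunE eqxx addr0.
by rewrite ffunE eq_sym (negPf il).
Qed.
End Components.

(** * Counting conjugacy orbits of generating tuples *)

Lemma mx_central_scalar (R : pzRingType) n' (g : 'M[R]_n'.+1) :
  (forall x, x *m g = g *m x) -> g = (g 0 0)%:M.
Proof.
move=> gC; apply/matrixP=> r i.
have /matrixP/(_ r 0) := gC (delta_mx i 0).
have -> : (g *m delta_mx i 0 : 'M[R]_n'.+1) r 0 = g r i.
  rewrite mxE (bigD1 i) //= big1 => [|s si]; last first.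
    by rewrite mxE (negPf si) mulr0.
  by rewrite mxE !eqxx mulr1 addr0.
have -> : ((delta_mx i 0 : 'M[R]_n'.+1) *m g) r 0 = g 0 0 *+ (r == i).
  rewrite mxE (bigD1 0) //= big1 => [|s s0]; last first.
    by rewrite mxE (negPf s0) andbF mul0r.
  by rewrite mxE eqxx andbT addr0 mulr_natl.
by move=> <-; rewrite !mxE.
Qed.

Section Orbits.
Variables (F : finFieldType) (m n' : nat).
Local Notation n := n'.+1.
Local Notation M := 'M[F]_n.
Local Notation T := {ffun 'I_m -> M}.

Definition conj_act (a : T) (g : {unit M}) : T :=
  [ffun y => (val g)^-1 * a y * val g].

Fact conj_act_is_action : is_action [set: {unit M}]%g conj_act.
Proof.
apply: is_total_action => [a|a g h]; apply/ffunP=> y; rewrite !ffunE.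
  by rewrite /= invr1 mul1r mulr1.
by rewrite /= invrM ?(valP g) ?(valP h) // !mulrA.
Qed.
Canonical conj_action := Action conj_act_is_action.

Lemma conj_actP (a b : T) :
  reflect (conjugate_mx a b) (b \in orbit conj_action [set: {unit M}]%g a).
Proof.
apply: (iffP orbitP) => [[g _ <-]|[g gu ag]].
  exists (val g); first exact: (valP g).
  move=> y; rewrite ffunE !mulmxE mulrA mulrA divrr ?mul1r //; exact: (valP g).
exists (FinRing.unit M gu); first by rewrite inE.
apply/ffunP=> y; rewrite ffunE /= -mulrA.
by have := ag y; rewrite !mulmxE => ->; rewrite mulrA mulVr ?mul1r.
Qed.

Definition generating_tuples : {set T} := [set a : T | `[< generates_mx a >]].

Lemma generating_tuplesP (a : T) :
  reflect (generates_mx a) (a \in generating_tuples).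
Proof. by rewrite inE; apply: asboolP. Qed.

Definition num_orbits : nat :=
  #|orbit conj_action [set: {unit M}]%g @: generating_tuples|.

Lemma conjugate_generates (J : Type) (a b : J -> M) :
  conjugate_mx a b -> generates_mx a -> generates_mx b.
Proof.
case=> g gu ag ga P [P0 PD PZ PM] Pb x.
have := ga (fun x => P (invmx g *m x *m g)) _ _ (g *m x *m invmx g).
rewrite !mulmxA mulVmx // mul1mx -mulmxA mulVmx // mulmx1; apply.
  split.
  - by rewrite mulmx0 mul0mx.
  - by move=> u v Pu Pv; rewrite mulmxDr mulmxDl; apply: PD.
  - by move=> c u Pu; rewrite -scalemxAr -scalemxAl; apply: PZ.
  - move=> u v Pu Pv; have := PM _ _ Pu Pv; rewrite -!mulmxE.
    by rewrite !mulmxA -(mulmxA _ g (invmx g)) mulmxV // mulmx1.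
by move=> y; rewrite -mulmxA ag mulmxA mulVmx // mul1mx.
Qed.

Lemma generating_tuples_acts :
  [acts [set: {unit M}]%g, on generating_tuples | conj_action].
Proof.
apply/actsP=> g _ a; have step (b : T) h : b \in generating_tuples ->
    conj_action b h \in generating_tuples.
  move=> /generating_tuplesP gb; apply/generating_tuplesP.
  apply: (conjugate_generates _ gb).
  by apply/conj_actP/mem_orbit; rewrite inE.
apply/idP/idP=> [/(step _ g^-1%g)|/step //]; rewrite actK //.
Qed.

(** A matrix that commutes with a generating tuple is central, hence scalar. *)
Lemma card_conj_stab a : a \in generating_tuples ->
  #|('C_[set: {unit M}][a | conj_action])%g| = #|F|.-1.
Proof.
move=> /generating_tuplesP ga.
rewrite -(card_imset _ val_inj) -(cardsC1 (0 : F)).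
have scal_inj : injective (@scalar_mx F n).
  by move=> c d /matrixP/(_ 0 0); rewrite !mxE eqxx.
rewrite -(card_imset _ scal_inj); apply: eq_card => /= x.
apply/imsetP/imsetP=> [[g]|[c c0 ->]].
  rewrite finset.inE => /andP[_ /astab1P ag] ->.
  have gC z : z *m val g = val g *m z.
    apply: (ga (fun z => z *m val g = val g *m z)) => [|y].
      split.
      - by rewrite mul0mx mulmx0.
      - by move=> u v eu ev; rewrite mulmxDl mulmxDr eu ev.
      - by move=> c u eu; rewrite -scalemxAl -scalemxAr eu.
      - by move=> u v eu ev; rewrite -mulmxE -mulmxA ev !mulmxA eu.
    move/ffunP/(_ y): ag; rewrite ffunE => {2}<-.
    by rewrite !mulmxE !mulrA divrr ?mul1r //; apply: (valP g).
  exists ((val g) 0 0); last exact: mx_central_scalar.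
  rewrite !inE; apply/eqP=> g00; have := valP g.
  by rewrite (mx_central_scalar gC) g00 raddf0 unitr0.
have cu : (c%:M : M) \is a GRing.unit.
  by rewrite rmorph_unit // unitfE; rewrite !inE in c0.
exists (FinRing.unit M cu) => //.
apply/finset.setIP; split; first by rewrite finset.inE.
apply/astab1P/ffunP=> y; rewrite ffunE /=.
by rewrite -mulrA -mulmxE scalar_mxC mulmxE mulrA mulVr // mul1r.
Qed.

Lemma card_conj_orbit a : a \in generating_tuples ->
  #|'GL_n[F]%g| =
    (#|orbit conj_action [set: {unit M}]%g a| * #|F|.-1)%N.
Proof. by move=> ga; rewrite -(card_conj_stab ga) card_orbit_stab. Qed.

Lemma card_generating_tuples :
  (#|generating_tuples| * #|F|.-1 = num_orbits * #|'GL_n[F]%g|)%N.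
Proof.
have q1 : (0 < #|F|.-1)%N by rewrite -subn1 subn_gt0 card_finRing_gt1.
have part := orbit_partition generating_tuples_acts.
rewrite (@card_uniform_partition _ (#|'GL_n[F]%g| %/ #|F|.-1) _ _ _ part).
  rewrite /num_orbits -mulnA.
  have [->|/finset.set0Pn[B /imsetP[a ga _]]] :=
    eqVneq (orbit conj_action [set: {unit M}]%g @: generating_tuples)
      finset.set0.
    by rewrite cards0.
  by rewrite divnK // (card_conj_orbit ga) dvdn_mull.
by move=> _ /imsetP[a ga ->]; rewrite (card_conj_orbit ga) mulnK.
Qed.

(** A generating m-tuple of the k-th power amounts to k distinct orbits of
    generating tuples, with a representative of each. *)
Lemma has_generators_num_orbits k :
  has_generators F n k m <-> (k <= num_orbits)%N.
Proof.
rewrite has_generatorsP; split=> [[S gS]|kN].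
  pose a i : T := [ffun y => S y i].
  have aE i : (a i : 'I_m -> M) = (fun y => S y i).
    by apply/funext=> y; rewrite ffunE.
  have inj : injective (fun i => orbit conj_action [set: {unit M}]%g (a i)).
    move=> i j eij; apply/eqP/negPn/negP => ij.
    apply: (generating_nonconj gS ij); rewrite -!aE.
    by apply/conj_actP; rewrite eij orbit_refl.
  rewrite -[k]card_ord -(card_imset _ inj); apply: subset_leq_card.
  apply/fintype.subsetP=> _ /imsetP[i _ ->]; apply: imset_f.
  apply/generating_tuplesP; rewrite aE.
  by apply: generating_component.
pose o (i : 'I_k) : {set T} := enum_val (widen_ord kN i).
have /choice[a aP] : forall i, exists a : T,
    a \in generating_tuples /\ o i = orbit conj_action [set: {unit M}]%g a.
  by move=> i; have /imsetP[a] := enum_valP (widen_ord kN i); exists a.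
exists (fun y => [ffun i => a i y]).
have aE i : (fun y => [ffun i => a i y] i) = a i.
  by apply/funext=> y; rewrite ffunE.
apply: generating_ffun => [i|i j ij]; rewrite !aE.
  by have [/generating_tuplesP] := aP i.
move/conj_actP => aij; case/negP: ij; apply/eqP/val_inj.
suff : widen_ord kN i = widen_ord kN j by move/(congr1 val).
apply: enum_val_inj; rewrite -/(o i) -/(o j); have [_ ->] := aP i.
by have [_ ->] := aP j; apply/esym/orbit_eqP.
Qed.

Lemma gen_num_orbits : gen m n F = (num_orbits)%:E.
Proof.
have isg g : is_gen m n F g <-> g = num_orbits.
  rewrite /is_gen !has_generators_num_orbits; split=> [[gN /negP]|->].
    by rewrite -ltnNge ltnS => Ng; apply/eqP; rewrite eqn_leq gN.
  by split=> //; rewrite ltnn.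
rewrite /gen; case: pselect => [h|[]]; last by exists num_orbits; apply/isg.
by congr (_%:E); apply/isg; exact: (projT2 (cid h)).
Qed.
End Orbits.

(** * A determinantal criterion for generation *)

Section WordMatrix.
Variable n' : nat.
Local Notation n := n'.+1.
Local Notation pairs := ('I_n * 'I_n)%type.

(** The rows are the words A^i B A^j and the columns are the matrix entries,
    both indexed by pairs.  The factor B keeps every word nonempty, so that
    they all lie in the subalgebra generated without identity. *)
Definition word_mx (R : comNzRingType) (A B : 'M[R]_n) : 'M[R]_#|{: pairs}| :=
  \matrix_(k < #|{: pairs}|, l < #|{: pairs}|)
    (A ^+ (enum_val k : pairs).1 * B * A ^+ (enum_val k : pairs).2)
    (enum_val l : pairs).1 (enum_val l : pairs).2.

Lemma word_mx_generates (F : fieldType) (J : Type) (a : J -> 'M[F]_n) y z :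
  \det (word_mx (a y) (a z)) != 0 -> generates_mx a.
Proof.
move=> detW P [P0 PD PZ PM] Pa x.
have Wu : word_mx (a y) (a z) \in unitmx by rewrite unitmxE unitfE.
pose v := \row_(l < #|{: pairs}|) x (enum_val l).1 (enum_val l).2.
pose c := v *m invmx (word_mx (a y) (a z)).
have -> : x = \sum_k c 0 k *:
    (a y ^+ (enum_val k : pairs).1 * a z * a y ^+ (enum_val k : pairs).2).
  apply/matrixP=> r s; have /rowP/(_ (enum_rank (r, s))) :
    c *m word_mx (a y) (a z) = v.
    by rewrite /c mulmxKV.
  rewrite !mxE enum_rankK /= => <-; rewrite summxE; apply: eq_bigr => k _.
  by rewrite !mxE enum_rankK.
elim/big_ind: _ => // k _; apply: PZ.
have PX i u : P u -> P (a y ^+ i * u).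
  by move=> Pu; elim: i => [|i IH]; rewrite ?mul1r // exprS -mulrA; apply: PM.
have PXr i u : P u -> P (u * a y ^+ i).
  by move=> Pu; elim: i => [|i IH]; rewrite ?mulr1 // exprSr mulrA; apply: PM.
by apply/PXr/PX.
Qed.

Lemma diag_mxX (R : comNzRingType) (d : 'rV[R]_n) i :
  diag_mx d ^+ i = diag_mx (\row_j d 0 j ^+ i).
Proof.
elim: i => [|i IH].
  by apply/matrixP=> r s; rewrite expr0 !mxE expr0.
rewrite exprS IH -mulmxE mulmx_diag; congr diag_mx.
by apply/rowP=> j; rewrite !mxE exprS.
Qed.

Lemma Vandermonde_unit (F : fieldType) (d : 'rV[F]_n) :
  injective (d 0) -> Vandermonde n d \in unitmx.
Proof.
move=> dI; rewrite unitmxE det_Vandermonde unitfE.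
apply/prodf_neq0 => i _; apply/prodf_neq0 => j ij.
by rewrite subr_eq0 (inj_eq dI); apply: contraTneq ij => ->; rewrite ltnn.
Qed.

(** For A diagonal with eigenvalues d and B with all entries 1, a combination
    of the words with coefficient matrix C is V^T C V, where V is the
    Vandermonde matrix of d. *)
Lemma det_word_mx_diag (F : fieldType) (d : 'rV[F]_n) :
  injective (d 0) -> \det (word_mx (diag_mx d) (const_mx 1)) != 0.
Proof.
move=> dI; rewrite -unitfE -unitmxE -row_free_unit -kermx_eq0.
apply/negPn/negP => /rowV0Pn[c]; rewrite sub_kermx => /eqP cW /negP[].
have WE i j r s : word_mx (diag_mx d) (const_mx 1) (enum_rank (i, j))
    (enum_rank (r, s)) = d 0 r ^+ i * d 0 s ^+ j.
  rewrite mxE !enum_rankK /= !diag_mxX -!mulmxE mul_mx_diag mul_diag_mx.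
  by rewrite !mxE mulr1.
pose C := \matrix_(i, j) c 0 (enum_rank (i, j)).
pose V := Vandermonde n d.
have Vu : V \in unitmx by apply: Vandermonde_unit.
(* entry (r, s) of V^T C V is the sum of d_r^i C_ij d_s^j *)
have VCV : V^T *m C *m V = 0.
  apply/matrixP=> r s; rewrite mxE [RHS]mxE.
  have /rowP/(_ (enum_rank (r, s))) := cW; rewrite !mxE => cWrs.
  rewrite -[RHS]cWrs.
  rewrite [RHS](reindex (@enum_rank _)) /=; last first.
    by apply: onW_bij; apply: enum_rank_bij.
  pose f i j := c 0 (enum_rank (i, j)) *
    word_mx (diag_mx d) (const_mx 1) (enum_rank (i, j)) (enum_rank (r, s)).
  rewrite [RHS](eq_bigr (fun p => f p.1 p.2)) => [|[i j] _ //].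
  rewrite -(pair_bigA _ f) /=.
  rewrite [RHS]exchange_big /=; apply: eq_bigr => j _.
  rewrite mxE mulr_suml; apply: eq_bigr => i _.
  by rewrite /f WE !mxE mulrAC mulrC.
have C0 : C = 0.
  have : invmx V^T *m (V^T *m C *m V) *m invmx V = 0.
    by rewrite VCV mulmx0 mul0mx.
  by rewrite !mulmxA mulVmx ?unitmx_tr // mul1mx -mulmxA mulmxV // mulmx1.
apply/eqP/rowP=> k; rewrite -(enum_valK k) mxE; case: (enum_val k) => i j.
by move/matrixP/(_ i j): C0; rewrite !mxE.
Qed.

Lemma map_word_mx (R S : comNzRingType) (f : {rmorphism R -> S})
    (A B : 'M[R]_n) :
  word_mx (map_mx f A) (map_mx f B) = map_mx f (word_mx A B).
Proof.
apply/matrixP=> k l; rewrite [LHS]mxE [RHS]mxE [in RHS]mxE.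
by rewrite -!rmorphXn -!rmorphM [LHS]mxE.
Qed.
End WordMatrix.

Section PolyDegree.
Variable R : comNzRingType.

Lemma size_mulmx_leq n (A B : 'M[{poly R}]_n) d e :
  (forall i j, size (A i j) <= d.+1)%N ->
  (forall i j, size (B i j) <= e.+1)%N ->
  forall i j, (size ((A *m B) i j) <= (d + e).+1)%N.
Proof.
move=> Ad Be i j; rewrite mxE; apply: (leq_trans (size_sum _ _ _)).
apply/bigmax_leqP => s _; apply: (leq_trans (size_polyMleq _ _)).
rewrite -ltnS; have := leq_add (Ad i s) (Be s j).
by rewrite addSn addnS; case: (_ + _)%N.
Qed.

Lemma size_expmx_leq n' (A : 'M[{poly R}]_n'.+1) d e :
  (forall i j, size (A i j) <= d.+1)%N ->
  forall i j, (size ((A ^+ e) i j) <= (d * e).+1)%N.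
Proof.
move=> Ad; elim: e => [|e IH] i j.
  by rewrite muln0 expr0 mxE; case: (_ == _); rewrite ?size_poly0 ?size_poly1.
by rewrite exprS -mulmxE mulnS; apply: size_mulmx_leq.
Qed.

Lemma size_det_leq n (A : 'M[{poly R}]_n) d :
  (forall i j, size (A i j) <= d.+1)%N -> (size (\det A) <= (d * n).+1)%N.
Proof.
move=> Ad; apply: (leq_trans (size_sum _ _ _)); apply/bigmax_leqP => s _.
rewrite -signr_odd mulr_sign; set p := \prod_i _.
have : (size p <= (d * n).+1)%N.
  apply: (leq_trans (size_prod_leq _ _)); rewrite leq_subLR.
  apply: (@leq_trans (\sum_(i < n) d.+1).+1).
    by rewrite ltnS; apply: leq_sum => i _; apply: Ad.
  by rewrite sum_nat_const card_ord mulnS addnS mulnC.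
by case: ifP => //; rewrite size_polyN.
Qed.
End PolyDegree.

(** * Most tuples generate *)

Lemma card_root_leq (F : finFieldType) (p : {poly F}) d :
  p != 0 -> (size p <= d.+1)%N -> (#|[set t | root p t]%SET| <= d)%N.
Proof.
move=> p0 sp; rewrite -ltnS; apply: leq_trans sp; rewrite cardE.
apply: max_poly_roots; rewrite ?enum_uniq //.
by apply/allP=> t; rewrite mem_enum inE.
Qed.

Section Counting.
Variables (F : finFieldType) (m n' : nat).
Local Notation n := n'.+1.
Local Notation M := 'M[F]_n.
Local Notation T := {ffun 'I_m -> M}.
Local Notation deg := (2 * n * (n * n))%N.

(** On a line through a point where the determinant does not vanish, the
    determinant is a nonzero polynomial of bounded degree in the parameter. *)
Lemma card_singular_pencil (A0 B0 A B : M) : \det (word_mx A0 B0) != 0 ->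
  (#|[set t | (\det (word_mx (A0 + t *: A) (B0 + t *: B)) == 0)%R]%SET|
    <= deg)%N.
Proof.
move=> det0.
(* the same pencil with the parameter replaced by an indeterminate *)
pose L (C0 C : M) := map_mx polyC C0 + 'X *: map_mx polyC C.
pose p := \det (word_mx (L A0 A) (L B0 B)).
have LE t C0 C : map_mx (horner_eval t) (L C0 C) = C0 + t *: C.
  by apply/matrixP=> i j; rewrite !mxE /horner_eval !hornerE.
have pE t : p.[t] = \det (word_mx (A0 + t *: A) (B0 + t *: B)).
  by rewrite -!LE map_word_mx det_map_mx.
have sL C0 C i j : (size (L C0 C i j) <= 2)%N.
  rewrite !mxE; apply: (leq_trans (size_polyD _ _)); rewrite geq_max.
  rewrite (leq_trans (size_polyC_leq1 _)) //=.
  apply: (leq_trans (size_polyMleq _ _)); rewrite size_polyX addSn /=.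
  by rewrite add1n ltnS size_polyC_leq1.
have p0 : p != 0.
  apply: contraNneq det0 => p0; have := pE 0.
  by rewrite p0 horner0 !scale0r !addr0 => <-.
have sp : (size p <= deg.+1)%N.
  have -> : (n * n)%N = #|{: 'I_n * 'I_n}| by rewrite card_prod card_ord.
  apply: size_det_leq => k l; rewrite mxE.
  set i := (enum_val k).1; set j := (enum_val k).2.
  apply: (@leq_trans (1 * i + 1 + 1 * j).+1).
    rewrite -!mulmxE; apply: size_mulmx_leq => [r s|].
      by apply: size_mulmx_leq r s => //; apply: size_expmx_leq.
    exact: size_expmx_leq.
  by rewrite !mul1n ltnS mul2n -addnn addn1 leq_add // ltnW.
apply: leq_trans (card_root_leq p0 sp); apply: subset_leq_card.
by apply/fintype.subsetP => t; rewrite !inE /root pE.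
Qed.

(** A tuple outside the generating set is singular, in the sense that the
    determinant of the words in its first two entries vanishes.  For t != 0 the
    map that sends a to a0 + t a is a bijection, so counting the pairs (a, t)
    with a0 + t a singular in two ways bounds the number of singular tuples. *)
Lemma card_nongenerating : (2 <= m)%N -> (n <= #|F|)%N ->
  ((#|T| - #|generating_tuples F m n'|) * #|F|.-1 <= deg * #|T|)%N.
Proof.
move=> m2 nF; pose y0 := Ordinal (ltnW m2); pose y1 := Ordinal m2.
pose d : 'rV[F]_n := \row_i enum_val (widen_ord nF i).
have dI : injective (d 0).
  move=> i j; rewrite !mxE => /enum_val_inj e; apply: val_inj.
  exact: (congr1 val e).
pose A0 : M := diag_mx d; pose B0 : M := const_mx 1.
pose a0 : T := [ffun y => if y == y0 then A0 else if y == y1 then B0 else 0].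
pose bad (a : T) := \det (word_mx (a y0) (a y1)) == 0.
have le_bad : (#|T| - #|generating_tuples F m n'| <= #|[set a | bad a]%SET|)%N.
  rewrite -[X in #|pred_of_set X|]finset.setCK -cardsCs; apply: subset_leq_card.
  apply/fintype.subsetP => a; rewrite !inE; apply: contraNT => good.
  by apply/asboolP; apply: word_mx_generates good.
apply: (leq_trans (leq_mul le_bad (leqnn _))).
have shiftE (t : F) : t != 0 ->
    (\sum_(a : T) bad (a0 + t *: a)%R = #|[set a | bad a]%SET|)%N.
  move=> t0; rewrite -sum1dep_card [RHS]big_mkcond /=.
  rewrite [RHS](reindex (fun a : T => a0 + t *: a)) /=.
    by apply: eq_bigr => a _; case: (bad _).
  exists (fun a : T => t^-1 *: (a - a0)) => a _.
    by rewrite addrC addKr scalerA mulVf // scale1r.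
  by rewrite scalerA mulfV // scale1r addrC subrK.
have -> : (#|[set a | bad a]%SET| * #|F|.-1 =
    \sum_(t : F | t != 0%R) \sum_(a : T) bad (a0 + t *: a)%R)%N.
  rewrite (eq_bigr (fun=> #|[set a | bad a]%SET|)) => [|t t0];
    last exact: shiftE.
  rewrite sum_nat_const mulnC; congr (_ * _)%N.
  by rewrite -(cardsC1 (0 : F)); apply: eq_card => t; rewrite !inE.
rewrite exchange_big /= mulnC -sum_nat_const; apply: leq_sum => a _.
have det0 : \det (word_mx A0 B0) != 0 by apply: det_word_mx_diag.
apply: leq_trans (card_singular_pencil (a y0) (a y1) det0).
rewrite -sum1dep_card big_mkcond [leqRHS]big_mkcond /=.
apply: leq_sum => t _; rewrite /bad !ffunE !eqxx /=.
by case: (t != 0); case: (_ == 0).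
Qed.
End Counting.

(** * The number of orbits and the proportion of generating tuples *)

Section Bound.
Variables (R : realType) (m n' : nat) (F : finFieldType).
Local Notation n := n'.+1.
Local Notation q := (#|F|%:R : R).
Local Notation T := {ffun 'I_m -> 'M[F]_n}.

Definition generating_ratio : R :=
  #|generating_tuples F m n'|%:R / #|{: T}|%:R.

Lemma card_field_gt1 : 1 < q.
Proof. by rewrite ltr1n card_finRing_gt1. Qed.

Lemma inv_card_field_lt1 k : (0 < k)%N -> q ^- k < 1.
Proof.
move=> k0; have q0 := lt_trans ltr01 card_field_gt1.
by rewrite invf_lt1 ?exprn_gt0 // exprn_egt1 -?lt0n // card_field_gt1.
Qed.

Lemma card_GL_real : #|'GL_n[F]%g|%:R =
  q ^+ (n ^ 2) * \prod_(1 <= k < n.+1) (1 - q ^- k).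
Proof.
have q0 : q != 0 by rewrite gt_eqF // (lt_trans _ card_field_gt1).
rewrite card_GL // natrM natrX natr_prod.
elim: n => [|k IH]; first by rewrite bin0n !big_geq // expr0 mulr1.
rewrite [in LHS]big_nat_recr //= [in RHS]big_nat_recr //=.
rewrite binS bin1 exprD mulrACA {}IH.
have -> : (k.+1 ^ 2 = k ^ 2 + k + k.+1)%N by lia.
have -> : (#|F| ^ k.+1 - 1)%:R = q ^+ k.+1 * (1 - q ^- k.+1).
  rewrite natrB ?expn_gt0 ?(ltnW (card_finRing_gt1 _)) // natrX.
  by rewrite mulrBr mulr1 divff // expf_neq0.
by rewrite !exprD; ring.
Qed.

(** Every orbit of generating tuples has |GL_n(F)| / (q - 1) elements, and
    the bound equals q^(m n^2) (q - 1) / |GL_n(F)|. *)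
Lemma num_orbits_ratio : (1 <= m)%N ->
  (num_orbits F m n')%:R = generating_ratio * gen_bound R m n #|F|.
Proof.
move=> m1; have q1 := card_field_gt1.
have q0 : q != 0 by rewrite gt_eqF // (lt_trans _ q1).
have P0 : \prod_(1 <= k < n.+1) (1 - q ^- k) != 0.
  rewrite prodf_seq_neq0; apply/allP => k.
  rewrite mem_index_iota => /andP[k1 _].
  by rewrite subr_eq0 gt_eqF // inv_card_field_lt1.
have := card_generating_tuples F m n'.
move/(congr1 (GRing.natmul (1 : R))); rewrite !natrM card_GL_real.
rewrite -subn1 natrB ?(ltnW (card_finRing_gt1 _)) // => e.
rewrite /generating_ratio /gen_bound card_ffun card_mx card_ord !natrX -exprM.
rewrite prodfV.
have -> : (n * n * m = n ^ 2 + (m - 1) * n ^ 2)%N by nia.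
apply: (mulIf (mulf_neq0 (expf_neq0 (n ^ 2) q0) P0)); rewrite -e exprD.
by field; rewrite P0 !expf_neq0.
Qed.

Lemma gen_bound_gt0 : 0 < gen_bound R m n #|F|.
Proof.
have q1 := card_field_gt1; have q0 := lt_trans ltr01 q1.
rewrite /gen_bound !mulr_gt0 ?subr_gt0 ?exprn_gt0 //.
rewrite big_seq_cond; apply: prodr_gt0 => k /andP[+ _].
rewrite mem_index_iota => /andP[k1 _].
by rewrite invr_gt0 subr_gt0 inv_card_field_lt1.
Qed.

Lemma card_tuples_gt0 : (0 : R) < #|{: T}|%:R.
Proof. by rewrite ltr0n; apply/card_gt0P; exists 0. Qed.

Lemma generating_ratio_lt1 : generating_ratio < 1.
Proof.
rewrite /generating_ratio ltr_pdivrMr ?card_tuples_gt0 // mul1r ltr_nat.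
apply: proper_card; apply/properP; split.
  exact/fintype.subsetP.
exists (0 : T) => //; apply/negP => /generating_tuplesP g0.
suff /eqP : (1 : 'M[F]_n) = 0 by rewrite oner_eq0.
apply: (g0 (fun x => x = 0)) => [|y]; last by rewrite ffunE.
by split=> [//|x y -> ->|c x ->|x y -> _]; rewrite ?addr0 ?scaler0 ?mul0r.
Qed.

(** The constant comes from the degree bound 2 n^3 and from q <= 2 (q - 1). *)
Lemma generating_ratio_ge : (2 <= m)%N -> (n <= #|F|)%N ->
  1 - (4 * n ^ 3)%:R / q <= generating_ratio.
Proof.
move=> m2 nF; have q1 := card_field_gt1; have q0 := lt_trans ltr01 q1.
have T0 := card_tuples_gt0.
have GT : (#|generating_tuples F m n'| <= #|{: T}|)%N by exact: max_card.
have := card_nongenerating m2 nF; rewrite -(ler_nat R) !natrM natrB // => h.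
have q2 : q <= 2 * #|F|.-1%:R.
  rewrite -natrM ler_nat; have := card_finRing_gt1 F.
  by case: #|F| => [|[|k]] //= _; lia.
rewrite /generating_ratio ler_pdivlMr // mulrBl mul1r lerBlDr -lerBlDl.
rewrite mulrAC ler_pdivlMr //.
apply: (@le_trans _ _ ((#|{: T}|%:R - #|generating_tuples F m n'|%:R) *
    (2 * #|F|.-1%:R))).
  by rewrite ler_wpM2l // subr_ge0 ler_nat.
rewrite mulrCA.
apply: (@le_trans _ _
    (2 * ((2%:R * n%:R) * (n%:R * n%:R) * #|{: T}|%:R))).
  by rewrite ler_wpM2l.
rewrite mulrA le_eqVlt; apply/orP; left; apply/eqP; congr (_ * _).
by rewrite -!natrM; congr (_%:R); nia.
Qed.
End Bound.

(** * Asymptotics *)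

Section Limits.
Local Open Scope classical_set_scope.
Variables (R : realType) (m n' : nat).
Local Notation n := n'.+1.

Let ratio q := generating_ratio R m n' (GF q).

Lemma genqE q : (1 <= m)%N -> prime_power q ->
  genq R m n q = (ratio q * gen_bound R m n q)%:E.
Proof.
move=> m1 qP; rewrite /genq gen_num_orbits /=; congr (_%:E).
by rewrite num_orbits_ratio // card_GF.
Qed.

Lemma cvg_invn : (q%:R^-1 : R) @[q --> \oo] --> (0 : R).
Proof. by rewrite -cvg_shiftS; apply: cvg_harmonic. Qed.

#[local] Instance prime_powers_infty_filter : Filter prime_powers_infty.
Proof. exact: within_filter. Qed.

Lemma cvg_ratio : (2 <= m)%N -> ratio q @[q --> prime_powers_infty] --> (1 : R).
Proof.
move=> m2.
apply: (@squeeze_cvgr _ _ _ _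
  (fun q => 1 - (4 * n ^ 3)%:R * q%:R^-1) (fun=> 1)).
- rewrite /prime_powers_infty; near=> q.
  have qP : prime_power q by near: q; apply: withinT.
  apply/andP; split; last exact/ltW/generating_ratio_lt1.
  have := @generating_ratio_ge R m n' (GF q) m2; rewrite card_GF //; apply.
  near: q; apply: cvg_within; exact: nbhs_infty_ge.
- apply: cvg_within_filter.
  have := cvgB (cvg_cst (1 : R)) (cvgM (cvg_cst ((4 * n ^ 3)%:R : R)) cvg_invn).
  by rewrite mulr0 subr0; apply.
- exact: cvg_cst.
Unshelve. all: by end_near.
Qed.

Lemma cvg_gen_bound : (1 <= m)%N ->
  gen_bound R m n q * (q%:R ^+ ((m - 1) * n ^ 2 + 1))^-1
    @[q --> \oo] --> (1 : R).
Proof.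
move=> m1.
have cX k : (0 < k)%N -> (1 - q%:R ^- k : R) @[q --> \oo] --> (1 : R).
  move=> k0; have cI : (q%:R ^- k : R) @[q --> \oo] --> (0 : R).
    case: k k0 => // k _; elim: k => [|k IH]; first exact: cvg_invn.
    under eq_fun do rewrite exprS invfM.
    by have := cvgM cvg_invn IH; rewrite mulr0; apply.
  by have := cvgB (cvg_cst (1 : R)) cI; rewrite subr0; apply.
have cP j :
    (\prod_(1 <= k < j.+1) (1 - q%:R ^- k)^-1 : R) @[q --> \oo] --> (1 : R).
  elim: j => [|j IH].
    under eq_fun do rewrite big_geq //.
    exact: (cvg_cst (1 : R)).
  under eq_fun do rewrite big_nat_recr //=.
  have := cvgM IH (cvgV (oner_neq0 R) (cX j.+1 isT)).
  by rewrite invr1 mulr1; apply.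
have := cvgM (cX 1%N isT) (cP n); rewrite mulr1 => h.
apply: (cvg_trans _ (h _)).
apply: near_eq_cvg; near=> q => /=.
have q0 : (q%:R : R) != 0.
  by rewrite pnatr_eq0 -lt0n; near: q; exact: nbhs_infty_ge.
rewrite /gen_bound exprD expr1; set P := \prod_(_ <= _ < _) _.
by field; rewrite q0 expf_neq0.
Unshelve. all: by end_near.
Qed.

(** The filter only sees prime powers, at which gen_{m,n}(q) is finite, so
    that the limit in the extended reals reduces to a limit in the reals. *)
Lemma asymp_equiv_genq (g : nat -> R) : (1 <= m)%N ->
  ratio q * (gen_bound R m n q * (g q)^-1)
    @[q --> prime_powers_infty] --> (1 : R) ->
  asymp_equiv (genq R m n) g.
Proof.
move=> m1 h; rewrite /asymp_equiv; set r := (fun q => _) in h.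
have hE : (r q)%:E @[q --> prime_powers_infty] --> (1 : R)%:E.
  by apply: cvg_EFin; [apply: nearW | exact: h].
apply: (cvg_trans _ hE); apply: near_eq_cvg.
rewrite /prime_powers_infty; near=> q => /=.
have qP : prime_power q by near: q; apply: withinT.
by rewrite genqE // /r -EFinM mulrA.
Unshelve. all: by end_near.
Qed.
End Limits.

Unset Implicit Arguments.

Theorem theorem3p2 (R : realType) (m n : nat) (hm : (2 <= m)%N)
    (hn : (2 <= n)%N) :
  [/\ (forall q : nat, prime_power q ->
         (genq R m n q < (gen_bound R m n q)%:E)%E),
      asymp_equiv (genq R m n) (gen_bound R m n) &
      asymp_equiv (genq R m n) (fun q => q%:R ^+ ((m - 1) * n ^ 2 + 1))].
Proof.
case: n hn => // n' _; have m1 : (1 <= m)%N := ltnW hm.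
have FF := prime_powers_infty_filter.
have bound_gt0 q : prime_power q -> 0 < gen_bound R m n'.+1 q.
  by move=> qP; rewrite -(card_GF qP) gen_bound_gt0.
split.
- move=> q qP; rewrite genqE // lte_fin.
  by rewrite gtr_pMl ?bound_gt0 // generating_ratio_lt1.
- apply: asymp_equiv_genq => //; have h := @cvg_ratio R m n' hm.
  apply: (cvg_trans _ h); apply: near_eq_cvg.
  rewrite /prime_powers_infty; near=> q => /=.
  have qP : prime_power q by near: q; apply: withinT.
  by rewrite divff ?mulr1 // gt_eqF // bound_gt0.
apply: asymp_equiv_genq => //.
have := cvgM (@cvg_ratio R m n' hm)
  (cvg_within_filter _ (@cvg_gen_bound R m n' m1)).
by rewrite mulr1; apply.
Unshelve. all: by end_near.
Qed.
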